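(* Let $(P_n(x))_{n\in\mathbb{N}_0}\subseteq\mathbb{R}[x]$ be a sequence given by $P_0(x)=1$, $P_1(x)=x$, $xP_n(x)=a_nP_{n+1}(x)+c_nP_{n-1}(x)$ $(n\in\mathbb{N})$ with $(c_n)_{n\in\mathbb{N}}\subseteq(0,1)$ and $a_n=1-c_n$, and assume that $(P_n(x))_{n\in\mathbb{N}_0}$ satisfies nonnegative linearization of products. If there exists a function $g:[-1,1]\rightarrow[0,\infty)$ such that $|P_n(x)|\leq g(x)$ for all $x\in[-1,1]$ and for all $n\in\mathbb{N}_0$, then $h(n)\geq 2$ for all $n\in\mathbb{N}$.
   Context: $\mathbb{N}=\{1,2,3,\ldots\}$ and $\mathbb{N}_0=\mathbb{N}\cup\{0\}$. A sequence $(P_n(x))_{n\in\mathbb{N}_0}$ given by such a recurrence satisfies $\deg P_n=n$ and $P_n(1)=1$ for all $n$, and it is orthogonal with respect to a unique probability Borel measure $\mu$ on $\mathbb{R}$, meaning that $\int_{\mathbb{R}}P_m(x)P_n(x)\,\mathrm{d}\mu(x)\neq 0\Leftrightarrow m=n$. Nonnegative linearization of products means that in the (unique) expansions $P_m(x)P_n(x)=\sum_{k=0}^{m+n}g(m,n;k)P_k(x)$ all coefficients $g(m,n;k)$ $(m,n,k\in\mathbb{N}_0)$ are nonnegative (these coefficients are unrelated to the bounding function $g$ in the claim). The Haar function is $h(n):=1/g(n,n;0)=1/\int_{\mathbb{R}}P_n^2(x)\,\mathrm{d}\mu(x)$; equivalently, $h(0)=1$ and $h(n)=\prod_{k=1}^n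 a_{k-1}/c_k$ for $n\in\mathbb{N}$, where $a_0:=1$. *)

(* Defs.v *)
From mathcomp Require Import all_boot all_order all_algebra.
From mathcomp Require Import boolp classical_sets reals.
Set Implicit Arguments.
Unset Strict Implicit.
Unset Printing Implicit Defensive.
Import Order.TTheory GRing.Theory Num.Theory.
Local Open Scope ring_scope.

(* gam lists the coefficients of P_m P_n in the basis (P_k), extended by 0 to
   the indices k > m + n. *)
Definition is_linearization (R : realType) (P : nat -> {poly R}) (m n : nat)
    (gam : nat -> R) : Prop :=
  (forall k, (m + n < k)%N -> gam k = 0) /\
  P m * P n = \sum_(0 <= k < (m + n).+1) gam k *: P k.

(* g(m, n; k). When deg P_n = n for all n, the expansion exists and is unique
   (lin_coefP and lin_coef_unique below); the default value 0 of xget is then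
   irrelevant. *)
Definition lin_coef (R : realType) (P : nat -> {poly R}) (m n k : nat) : R :=
  @xget (nat -> R) (fun=> 0) [set gam | is_linearization P m n gam]%classic k.

Definition nonneg_linearization (R : realType) (P : nat -> {poly R}) : Prop :=
  forall m n k, 0 <= lin_coef P m n k.

Definition haar (R : realType) (P : nat -> {poly R}) (n : nat) : R :=
  1 / lin_coef P n n 0%N.

Lemma expansion_exists (R : realType) (P : nat -> {poly R})
    (sP : forall n, size (P n) = n.+1) (N : nat) (p : {poly R}) :
  (size p <= N)%N ->
  exists gam : nat -> R, (forall k, (N <= k)%N -> gam k = 0) /\
    p = \sum_(0 <= k < N) gam k *: P k.
Proof.
elim: N p => [|N IHN] p.
  rewrite leqn0 size_poly_eq0 => /eqP ->.
  by exists (fun=> 0); split=> //; rewrite big_geq.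
move=> sp; set b := p`_N / (P N)`_N.
have lcN : (P N)`_N != 0.
  have := lead_coef_eq0 (P N); rewrite lead_coefE sP /= => ->.
  by rewrite -size_poly_eq0 sP.
have [|gam [gam0 def_gam]] := IHN (p - b *: P N).
  apply/leq_sizeP => j; rewrite leq_eqVlt => /predU1P[<-|ltNj].
    by rewrite coefB coefZ divfK // subrr.
  by rewrite coefB coefZ !nth_default ?sP ?mulr0 ?subr0 // (leq_trans sp).
exists (fun k => if k == N then b else gam k); split=> [k ltNk|].
  by rewrite gtn_eqF // gam0 // ltnW.
rewrite big_nat_recr //= eqxx -[LHS](subrK (b *: P N)) def_gam; congr (_ + _).
by apply: eq_big_nat => k /andP[_ ltkN]; rewrite ltn_eqF.
Qed.

Lemma expansion_eq0 (R : realType) (P : nat -> {poly R})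
    (sP : forall n, size (P n) = n.+1) (N : nat) (gam : nat -> R) :
  \sum_(0 <= k < N) gam k *: P k = 0 -> forall k, (k < N)%N -> gam k = 0.
Proof.
elim: N => [//|N IHN]; rewrite big_nat_recr //= => sum0.
have lcN : (P N)`_N != 0.
  have := lead_coef_eq0 (P N); rewrite lead_coefE sP /= => ->.
  by rewrite -size_poly_eq0 sP.
have gamN : gam N = 0.
  have := congr1 (fun p : {poly R} => p`_N) sum0.
  rewrite /= coefD coefZ coef0 coef_sum big_nat big1 => [|k /andP[_ ltkN]].
    by rewrite add0r => /eqP; rewrite mulf_eq0 (negPf lcN) orbF => /eqP.
  by rewrite coefZ nth_default ?mulr0 // sP.
move: sum0; rewrite gamN scale0r addr0 => /IHN gam0 k.
by rewrite ltnS leq_eqVlt => /predU1P[->|/gam0].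
Qed.

Lemma lin_coefP (R : realType) (P : nat -> {poly R})
    (sP : forall n, size (P n) = n.+1) (m n : nat) :
  is_linearization P m n (lin_coef P m n).
Proof.
have smn : (size (P m * P n)%R <= (m + n).+1)%N.
  by apply: leq_trans (size_polyMleq _ _) _; rewrite !sP addSn addnS.
have [gam gamP] := expansion_exists sP smn.
exact: (@xgetPex _ (fun=> 0) [set gam | is_linearization P m n gam]%classic
  (ex_intro _ gam gamP)).
Qed.

Lemma lin_coef_unique (R : realType) (P : nat -> {poly R})
    (sP : forall n, size (P n) = n.+1) (m n : nat) (gam : nat -> R) :
  is_linearization P m n gam -> forall k, gam k = lin_coef P m n k.
Proof.
case=> gam0 gamE k; have [lc0 lcE] := lin_coefP sP m n.
have [ltk|lek] := ltnP (m + n) k; first by rewrite gam0 // lc0.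
apply/eqP; rewrite -subr_eq0; apply/eqP.
apply: (expansion_eq0 sP (N := (m + n).+1)
  (gam := fun k => gam k - lin_coef P m n k)) => //.
under eq_bigr do rewrite scalerBl.
by rewrite sumrB -gamE -lcE subrr.
Qed.

Lemma size_recurrence (R : realType) (a c : nat -> R) (P : nat -> {poly R}) :
  (forall n, (0 < n)%N -> 0 < c n < 1) ->
  (forall n, (0 < n)%N -> a n = 1 - c n) ->
  P 0%N = 1 -> P 1%N = 'X ->
  (forall n, (0 < n)%N -> 'X * P n = a n *: P n.+1 + c n *: P n.-1) ->
  forall n, size (P n) = n.+1.
Proof.
move=> c01 aE P0 P1 rec n.
suff [] : size (P n) = n.+1 /\ size (P n.+1) = n.+2 by [].
elim: n => [|n [IH0 IH1]]; first by rewrite P0 P1 size_poly1 size_polyX.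
split=> //; have an0 : a n.+1 != 0.
  by rewrite aE // subr_eq0 gt_eqF //; case/andP: (c01 n.+1 isT).
rewrite -(size_scale _ an0).
have -> : a n.+1 *: P n.+2 = 'X * P n.+1 - c n.+1 *: P n.
  by rewrite rec //= addrK.
have PS0 : P n.+1 != 0 by rewrite -size_poly_eq0 IH1.
have sXP : size ('X * P n.+1)%R = n.+3 by rewrite mulrC size_mulX // IH1.
rewrite size_polyDl // sXP size_polyN.
by apply: leq_ltn_trans (size_scale_leq _ _) _; rewrite IH0.
Qed.

(* Main.v *)
Require Import Defs.
From mathcomp Require Import all_boot all_order all_algebra.
From mathcomp Require Import reals.
From mathcomp Require Import boolp classical_sets polyrcf zify lra.
Set Implicit Arguments.
Unset Strict Implicit.
Unset Printing Implicit Defensive.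
Import Order.TTheory GRing.Theory Num.Theory.
Local Open Scope ring_scope.

(* Write P_n^2 = sum_k g(n,n;k) P_k, where the coefficients are nonnegative and
   sum to 1, as one sees at x = 1. If M is the supremum of the |P_n(x)|, then
   M^2 <= M, so pointwise boundedness forces |P_n(x)| <= 1 on [-1,1]. Evaluating
   the expansion at a zero of P_n in [0,1) gives
   0 >= g(n,n;0) - (1 - g(n,n;0)), that is, g(n,n;0) <= 1/2. *)

(** An algebraic substitute for integration against the orthogonality measure: when [P 0 = 1], that
    integral is the coordinate along [P 0]. *)
Lemma coord0_functional (R : realType) (P : nat -> {poly R}) :
  (forall n, size (P n) = n.+1) ->
  exists L : {poly R} -> R,
    (forall r p q, L (r *: p + q) = r * L p + L q) /\
    (forall n, L (P n) = (n == 0%N)%:R).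
Proof.
move=> sP.
pose expn_of (p : {poly R}) (gam : nat -> R) :=
  (forall k, (size p <= k)%N -> gam k = 0) /\
  p = \sum_(0 <= k < size p) gam k *: P k.
have /choice[G GP] p : exists gam, expn_of p gam.
  exact: expansion_exists sP (size p) p (leqnn _).
have GE (p : {poly R}) N : (size p <= N)%N -> p = \sum_(0 <= k < N) G p k *: P k.
  move=> leN; have [G0 Gp] := GP p.
  rewrite (big_cat_nat (leq0n _) leN) //= -Gp [X in _ + X]big_nat big1 ?addr0 // => k.
  by case/andP=> /G0 -> _; rewrite scale0r.
have Guniq (p : {poly R}) N (gam : nat -> R) : (size p <= N.+1)%N ->
    p = \sum_(0 <= k < N.+1) gam k *: P k -> G p 0%N = gam 0%N.
  move=> leN pE; apply/eqP; rewrite -subr_eq0; apply/eqP.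
  apply: (expansion_eq0 sP (N := N.+1) (gam := fun k => G p k - gam k)) => //.
  under eq_bigr do rewrite scalerBl.
  by rewrite sumrB -pE -GE // subrr.
exists (fun p => G p 0%N); split=> [r p q|n].
  (* One length bounding all three sizes lets the padded expansions be added term by term, even if
     leading terms cancel. *)
  set N := (size (r *: p + q)%R + size p + size q)%N.
  apply: (Guniq _ N (fun k => r * G p k + G q k)); first by rewrite /N; lia.
  under eq_bigr do rewrite scalerDl -scalerA.
  by rewrite big_split -scaler_sumr -!GE // /N; lia.
rewrite (Guniq _ n (fun k => (n == k)%:R)) ?sP // big_nat_recr //= eqxx scale1r.
rewrite big_nat big1 ?add0r // => k /andP[_ ltkn].
by rewrite gtn_eqF // scale0r.
Qed.

Lemma largest_root (R : realType) (p : {poly R}) (a b : R) :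
  a < b -> p.[a] < 0 -> 0 < p.[b] ->
  exists y, [/\ a < y < b, p.[y] = 0 & forall z, y < z <= b -> 0 < p.[z]].
Proof.
move=> ab pa pb.
have [|r rab pr0] := poly_ivtoo (ltW ab) (p := p); first by rewrite nmulr_rlt0.
(* A nonpositive value at [z] would force a zero in [[z, b]], and it is not [b] because [p.[b] >
   0]. *)
have Pos y : (forall z, y < z < b -> ~~ root p z) ->
    forall z, y < z <= b -> 0 < p.[z].
  move=> nr z /andP[yz zb]; rewrite ltNge; apply/negP=> pz.
  have [|s] := poly_ivt zb (p := p); first by rewrite pz ltW.
  move=> /andP[zs sb] ps0; move: sb; rewrite le_eqVlt.
  case/predU1P=> [sE|sb].
    by move: ps0 pb; rewrite sE => /rootP ->; rewrite ltxx.
  by have := nr s; rewrite ps0 (lt_le_trans yz zs) sb => /(_ isT).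
case: (prev_rootP p a b) => [p0|y p0 py yab nr|d p0 _ nr].
- by move: pb; rewrite p0 horner0 ltxx.
- exists y; split=> //.
  by apply: Pos => z zyb; apply: nr; rewrite in_itv.
- by have := nr r rab; rewrite pr0.
Qed.

Section Recurrence.

Variables (R : realType) (a c : nat -> R) (P : nat -> {poly R}).
Hypothesis c01 : forall n : nat, (0 < n)%N -> 0 < c n < 1.
Hypothesis aE : forall n : nat, (0 < n)%N -> a n = 1 - c n.
Hypotheses (P0 : P 0%N = 1) (P1 : P 1%N = 'X).
Hypothesis rec : forall n : nat, (0 < n)%N ->
  'X * P n = a n *: P n.+1 + c n *: P n.-1.

Let sP : forall n, size (P n) = n.+1 := size_recurrence c01 aE P0 P1 rec.

Let a_gt0 n : (0 < n)%N -> 0 < a n.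
Proof. by move=> n0; rewrite aE // subr_gt0; case/andP: (c01 n0). Qed.

Let c_gt0 n : (0 < n)%N -> 0 < c n.
Proof. by move=> n0; case/andP: (c01 n0). Qed.

Let rec_horner n x :
  x * (P n.+1).[x] = a n.+1 * (P n.+2).[x] + c n.+1 * (P n).[x].
Proof. by rewrite -[x in x * _]hornerX -hornerM rec // hornerD !hornerZ. Qed.

Lemma horner1_recurrence n : (P n).[1] = 1.
Proof.
suff [] : (P n).[1] = 1 /\ (P n.+1).[1] = 1 by [].
elim: n => [|n [IH0 IH1]]; first by rewrite P0 P1 hornerC hornerX.
split=> //; have := rec_horner n 1; rewrite IH0 IH1 !mulr1 => h.
have a0 := a_gt0 (ltn0Sn n); apply: (mulfI (lt0r_neq0 a0)).
by rewrite mulr1 [in RHS]aE //; lra.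
Qed.

(* Consecutive polynomials have opposite signs at x, since
   a_n P_(n+1)(x) = - c_n P_(n-1)(x) at a zero x of P_n; hence P_(n+1) has a
   zero to the right of the largest zero of P_n. *)
Lemma root_recurrence n : (0 < n)%N -> exists2 x, 0 <= x < 1 & (P n).[x] = 0.
Proof.
case: n => // n _.
(* The invariant carries signs too: positivity of [P n.+1] to the right of [x] gives its positivity
   at the next zero [y > x]. *)
suff [x [x01 Px _ _]] : exists x, [/\ 0 <= x < 1, (P n.+1).[x] = 0,
    0 < (P n).[x] & forall z, x < z <= 1 -> 0 < (P n.+1).[z]] by exists x.
elim: n => [|n [x [/andP[x0 x1] Px Pnx Pz]]].
  exists 0; rewrite P0 P1 hornerX hornerC lexx !ltr01; split=> // z /andP[].
  by rewrite hornerX.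
have Pneg : (P n.+2).[x] < 0.
  rewrite -(pmulr_rlt0 _ (a_gt0 (ltn0Sn n))).
  have := rec_horner n x; rewrite Px mulr0.
  by have := mulr_gt0 (c_gt0 (ltn0Sn n)) Pnx; lra.
have [|y [/andP[xy y1] Py Pyz]] := largest_root x1 Pneg.
  by rewrite horner1_recurrence.
by exists y; split=> //; [lra|apply: Pz; rewrite xy ltW].
Qed.

(* Rules out the junk value 1 / 0 = 0 of the Haar function. The proof computes
   L(P_n^2), L being the moment functional of the orthogonality measure. *)
Lemma lin_coef_diag_gt0 n : 0 < lin_coef P n n 0%N.
Proof.
have [L [L_lin LP]] := coord0_functional sP.
have L0 : L 0 = 0 by have := L_lin (-1) 0 0; rewrite scaler0 addr0; lra.
have LD p q : L (p + q) = L p + L q by rewrite -[p]scale1r L_lin scale1r mul1r.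
have LZ r p : L (r *: p) = r * L p by rewrite -[r *: p]addr0 L_lin L0 addr0.
have -> : lin_coef P n n 0%N = L (P n * P n).
  have [_ ->] := lin_coefP sP n n.
  rewrite (big_morph L LD L0) big_nat_recl // LZ LP mulr1 big1 ?addr0 // => k _.
  by rewrite LZ LP mulr0.
have Lrec m k : a m.+1 * L (P m.+2 * P k.+1) + c m.+1 * L (P m * P k.+1) =
    a k.+1 * L (P m.+1 * P k.+2) + c k.+1 * L (P m.+1 * P k).
  transitivity (L ('X * P m.+1 * P k.+1)).
    by rewrite rec // mulrDl -!scalerAl LD !LZ.
  by rewrite (mulrC 'X) -mulrA rec // mulrDr -!scalerAr LD !LZ.
(* Two consecutive indices are carried because [Lrec] reaches [k.+2] from [k.+1] and [k]. *)
have orth k : (forall m, (k < m)%N -> L (P m * P k) = 0) /\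
    (forall m, (k.+1 < m)%N -> L (P m * P k.+1) = 0).
  elim: k => [|k [IH0 IH1]].
    split=> [[//|m] _|[//|[//|m]] _]; first by rewrite P0 mulr1 LP.
    by rewrite P1 mulrC rec // LD !LZ !LP !mulr0 addr0.
  split=> // -[//|m] km; have := Lrec m k.
  rewrite IH1 ?IH1 ?IH0 ?mulr0 ?addr0; try lia.
  by move/esym/eqP; rewrite mulf_eq0 gt_eqF ?a_gt0 //= => /eqP.
elim: n => [|n IHn]; first by rewrite P0 mulr1 -P0 LP.
case: n => [|n] in IHn *.
  by rewrite P1 -[X in _ * X]P1 rec // LD !LZ !LP mulr0 add0r mulr1 c_gt0.
(* By orthogonality [Lrec] reduces to [a n.+1 * L (P n.+2 ^+ 2) = c n.+2 * L (P n.+1 ^+ 2)], the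
   step of the product formula for the Haar function. *)
rewrite -(pmulr_rgt0 _ (a_gt0 (ltn0Sn n))).
have := Lrec n.+1 n; have [orthn orthn1] := orth n.
rewrite orthn1 // orthn // !mulr0 add0r addr0 => <-.
by rewrite mulr_gt0 ?c_gt0.
Qed.

Lemma sum_lin_coef n : \sum_(0 <= k < (n + n).+1) lin_coef P n n k = 1.
Proof.
have [_ /(congr1 (horner^~ 1))] := lin_coefP sP n n.
rewrite hornerM horner1_recurrence mulr1 horner_sum => ->.
by apply: eq_bigr => k _; rewrite hornerZ horner1_recurrence mulr1.
Qed.

Hypothesis hlin : nonneg_linearization P.

(** At the fixed [x], the square of [P n] is a convex combination of values of modulus at most the
    supremum M. *)
Lemma bounded_by_1 x B : (forall n, `|(P n).[x]| <= B) ->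
  forall n, `|(P n).[x]| <= 1.
Proof.
move=> PB; pose S : set R := [set y | exists n, y = `|(P n).[x]|]%classic.
have PS n : `|(P n).[x]| <= sup S.
  by apply: ub_le_sup; [exists B => _ [m ->]|exists n].
have M0 : 0 <= sup S by apply: le_trans (PS 0%N).
(* In this form M^2 <= M follows by showing that the square root of M is an upper bound of [S]. *)
suff M1 : sup S <= Num.sqrt (sup S).
  suff : sup S <= 1 by move=> h n; apply: le_trans h.
  have := sqr_sqrtr M0; have := sqrtr_ge0 (sup S); nra.
apply: ge_sup => [|_ [n ->]]; first by exists `|(P 0).[x]|, 0%N.
rewrite -(ler_pXn2r (ltn0Sn 1)) ?nnegrE ?sqrtr_ge0 // sqr_sqrtr //.
rewrite -normrX expr2 -hornerM; have [_ ->] := lin_coefP sP n n.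
rewrite horner_sum (le_trans (ler_norm_sum _ _ _)) //.
rewrite -[leRHS]mul1r -(sum_lin_coef n) mulr_suml ler_sum // => k _.
by rewrite hornerZ normrM ger0_norm // ler_wpM2l.
Qed.

End Recurrence.

Theorem corollary2p2 (R : realType) (a c : nat -> R) (P : nat -> {poly R})
    (hc : forall n : nat, (0 < n)%N -> 0 < c n < 1)
    (ha : forall n : nat, (0 < n)%N -> a n = 1 - c n)
    (hP0 : P 0%N = 1) (hP1 : P 1%N = 'X)
    (hrec : forall n : nat, (0 < n)%N ->
      'X * P n = a n *: P n.+1 + c n *: P n.-1)
    (hlin : nonneg_linearization P)
    (hbound : exists g : R -> R, forall x : R, -1 <= x <= 1 ->
      0 <= g x /\ forall n : nat, `|(P n).[x]| <= g x) :
  forall n : nat, (0 < n)%N -> 2 <= haar P n.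
Proof.
move=> n n0; have [x x01 Pnx] := root_recurrence hc ha hP0 hP1 hrec n0.
have [g gP] := hbound; have [|_ gx] := gP x; first by lra.
have P1 := bounded_by_1 hc ha hP0 hP1 hrec hlin gx.
rewrite /haar ler_pdivlMr; last exact: lin_coef_diag_gt0 hc ha hP0 hP1 hrec n.
have := sum_lin_coef hc ha hP0 hP1 hrec n.
have sP := size_recurrence hc ha hP0 hP1 hrec.
have [_ /(congr1 (horner^~ x))] := lin_coefP sP n n.
rewrite hornerM Pnx mulr0 horner_sum !big_nat_recl // hornerZ hP0 hornerC.
set S := \sum_(_ <= _ < _) _; set T := \sum_(_ <= _ < _) _ => SE TE.
(* With g = [lin_coef P n n 0], the two expansions read g + S = 0 at [x] and g + T = 1 at 1, so - T
   <= S amounts to 2g <= 1. *)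
suff : - T <= S by lra.
rewrite -sumrN ler_sum // => k _; rewrite hornerZ -mulrN1 ler_wpM2l //.
by have := P1 k.+1; rewrite ler_norml => /andP[].
Qed.
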